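(* Let $p\geq 7$ be a prime number. Consider the left braces, up to isomorphism, with additive group $\mathbf{Z}_p\times C_{12}$ and multiplicative group a semidirect product $\mathbf{Z}_p\rtimes\mathrm{Dic}_{12}$. 1) If $p\not\equiv 1\pmod 4$ there are 2 such braces. One of them is a direct product and the other one has a kernel of order 6. 2) If $p\equiv 1\pmod 4$ there are 3 such braces. One of them is a direct product, and the other two have kernels of order 6 and 3, respectively.
   Context: A left brace is a set $B$ with operations $+,\cdot$ such that $(B,+)$ is an abelian group (additive group), $(B,\cdot)$ is a group (multiplicative group), and $a(b+c)=ab-a+ac$ for all $a,b,c\in B$. Isomorphisms are bijections preserving both operations. $\mathbf{Z}_m=\mathbf{Z}/m\mathbf{Z}$, $C_m$ is the cyclic group of order $m$, and $\mathrm{Dic}_{12}=\langle x,y\mid x^3=1,y^4=1,yxy^{-1}=x^2\rangle$ is the dicyclic group of order 12. Given a left brace $B'$ of size 12 with multiplicative group $F$ and a group morphism $\tau:F\to\mathrm{Aut}(\mathbf{Z}_p)\simeq\mathbf{Z}_p^*$, the semidirect product of the trivial brace $\mathbf{Z}_p$ (with $a\cdot b=a+b$) and $B'$ via $\tau$ is $\mathbf{Z}_p\times B'$ with componentwise addition and $(a,b)\cdot(a',b')=(a+\tau(b)a',bb')$; it is the direct product of braces when $\tau$ is trivial. For $p\geq 7$ every left brace of size $12p$ is isomorphic to one of this form. The kernel of the brace means $\ker\tau\subseteq F$. ''Multiplicative group $\mathbf{Z}_p\rtimes F$'' means isomorphic to $\mathbf{Z}_p\rtimes_\tau F$ for some $\tau$,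 possibly trivial. *)

(* Defs.v *)
From HB Require Import structures.
From mathcomp Require Import all_boot all_order all_algebra all_fingroup.

Set Implicit Arguments.
Unset Strict Implicit.
Unset Printing Implicit Defensive.

Import GRing.Theory.

Local Open Scope ring_scope.

HB.mixin Record isLeftBrace B of GRing.Zmodule B & monoid.Group B := {
  brace_mulgDr : forall a b c : B,
    (a * (b + c)%R)%g = (a * b)%g - a + (a * c)%g
}.

#[short(type="leftBraceType")]
HB.structure Definition LeftBrace :=
  {B of GRing.Zmodule B & monoid.Group B & isLeftBrace B}.

Definition brace_iso (B1 B2 : leftBraceType) : Prop :=
  exists f : B1 -> B2,
    [/\ bijective f, {morph f : a b / a + b} & {morph f : a b / (a * b)%g}].

Definition add_iso (U V : zmodType) : Prop :=
  exists f : U -> V, bijective f /\ {morph f : a b / a + b}.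

Definition mul_iso (G H : groupType) : Prop :=
  exists f : G -> H, bijective f /\ {morph f : a b / (a * b)%g}.

Definition has_order (T : Type) (n : nat) : Prop :=
  exists f : 'I_n -> T, bijective f.

(* Aut(Z_p) is identified with the group of units of the field 'F_p, a unit u
   acting by a |-> u * a; everything below is meant for p prime, in which case
   'F_p is Z/pZ. *)
Definition semidirect (p : nat) (F : groupType)
  (tau : {multiplicative F -> {unit 'F_p}}) : Type := ('F_p * F)%type.

Section SemidirectGroup.
Variables (p : nat) (F : groupType) (tau : {multiplicative F -> {unit 'F_p}}).
Implicit Types x y z : semidirect tau.

Definition sd_mul x y : semidirect tau :=
  (x.1 + val (tau x.2) * y.1, (x.2 * y.2)%g).
Definition sd_one : semidirect tau := (0, 1%g).
Definition sd_inv x : semidirect tau :=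
  (- (val (tau x.2^-1%g) * x.1), x.2^-1%g).

Fact sd_mulA : associative sd_mul.
Proof.
move=> [a b] [a' b'] [a'' b'']; rewrite /sd_mul /= gmulfM mulgA.
by rewrite FinRing.val_unitM mulrDr mulrA addrA.
Qed.

Fact tau1 : tau 1%g = 1%g.
Proof. by apply: (@mulgI _ (tau 1%g)); rewrite -gmulfM !mulg1. Qed.

Fact sd_mul1 : left_id sd_one sd_mul.
Proof.
by case=> a b; rewrite /sd_mul /= tau1 FinRing.val_unit1 mul1r add0r mul1g.
Qed.

Fact sd_mulr1 : right_id sd_one sd_mul.
Proof. by case=> a b; rewrite /sd_mul /= mulr0 addr0 mulg1. Qed.

Fact sd_mulV : left_inverse sd_one sd_inv sd_mul.
Proof. by case=> a b; rewrite /sd_mul /= addNr mulVg. Qed.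

Fact sd_mulVr : right_inverse sd_one sd_inv sd_mul.
Proof.
case=> a b; rewrite /sd_mul /= mulrN mulrA -FinRing.val_unitM -gmulfM mulgV.
by rewrite tau1 FinRing.val_unit1 mul1r subrr.
Qed.

HB.instance Definition _ := Choice.on (semidirect tau).
HB.instance Definition _ := isGroup.Build (semidirect tau)
  sd_mulA sd_mul1 sd_mulr1 sd_mulV sd_mulVr.

End SemidirectGroup.

Section SemidirectBrace.
Variables (p : nat) (B' : leftBraceType).
Variable tau : {multiplicative B' -> {unit 'F_p}}.

(* The additive group is the direct product of those of 'F_p and B'. *)
HB.instance Definition _ :=
  GRing.Zmodule.copy (semidirect tau) ('F_p * B')%type.

Fact semidirect_mulgDr (x y z : semidirect tau) :
  (x * (y + z)%R)%g = (x * y)%g - x + (x * z)%g.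
Proof.
case: x y z => [a b] [a1 b1] [a2 b2]; congr (_, _) => /=; last first.
  exact: brace_mulgDr.
by rewrite mulrDr (addrC a (_ * a1)) addrK addrCA.
Qed.

HB.instance Definition _ := isLeftBrace.Build (semidirect tau) semidirect_mulgDr.

End SemidirectBrace.

(* Grp characterises G by its finite homomorphic images; the presented group is
   finite, so this determines G up to isomorphism. *)
Definition is_Dic12 (G : finGroupType) : Prop :=
  [set: G] \isog Grp (x : y : x ^+ 3, y ^+ 4, y * x * y^-1 = x ^+ 2)%g.

(* B is the semidirect product of the trivial brace Z_p and a brace of size 12
   via a morphism whose kernel has order k. *)
Definition has_kernel_of_order (p : nat) (B : leftBraceType) (k : nat) : Prop :=
  exists (B' : leftBraceType) (tau : {multiplicative B' -> {unit 'F_p}}),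
    [/\ has_order B' 12, brace_iso B (semidirect tau)
      & has_order {b : B' | tau b == 1%g} k].

Definition is_direct_product (p : nat) (B : leftBraceType) : Prop :=
  exists (B' : leftBraceType) (tau : {multiplicative B' -> {unit 'F_p}}),
    [/\ has_order B' 12, brace_iso B (semidirect tau)
      & forall b, tau b = 1%g].

Definition C12_Dic12_brace (p : nat) (B : leftBraceType) : Prop :=
  add_iso B ('F_p * 'Z_12)%type
  /\ exists2 D : finGroupType, is_Dic12 D
     & exists tau : {multiplicative D -> {unit 'F_p}},
         mul_iso B (semidirect tau).

(* The n braces B i are a complete irredundant system of representatives, up to
   isomorphism, of the braces satisfying P; i.e. there are n such braces. *)
Definition classifies (P : leftBraceType -> Prop) (n : nat)
    (B : 'I_n -> leftBraceType) : Prop :=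
  [/\ forall i, P (B i),
      forall i j, brace_iso (B i) (B j) -> i = j
    & forall C, P C -> exists i, brace_iso C (B i)].

(* Main.v *)
From HB Require Import structures.
Require Import Defs.
From mathcomp Require Import all_boot all_order all_algebra all_fingroup.
From mathcomp Require Import all_solvable.

(** The proof gives an explicit normal form. On Z_12 the operation
    x o y = x + 5^x y is a left brace operation whose multiplicative group is
    Dic_12 (here [dic], see [dic_is_Dic12]), and for a unit u of Z_p with
    u^4 = 1 the map x |-> u^x is a character of it. Hence a brace
    [dic_brace u] := Z_p x| dic for each such u.

    Every brace C as in the theorem is one of these. Transport the additive
    group of C to Z_p x Z_12. The maps v |-> uv - u are additive, hence, p being
    prime to 12, they are diagonal: u acts on Z_p by a scalar S(u) and on
    Z_12 by a scalar T(u), and S, T are multiplicative. For u in the additive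
    Sylow p-subgroup both scalars are 1. For S this is a fixed point argument:
    if S(u) <> 1, the affine map b |-> a + S(u) b fixes some b, that is,
    u * b = b, so u = 1. For T, all units of Z_12 square to 1 while every
    element of Z_p is a double. So C is determined by the restrictions of S and
    T to the complement H = {h_x : x in Z_12}, on which
    h_x h_y = h_(x + T(h_x) y). The projection of the multiplicative group of C
    onto Dic_12 has a kernel of exponent p, so it is bijective on H. The structure
    of Dic_12 now forces T: the fixed point argument gives T(h_4) = 1; the
    involution of Dic_12 being unique, T(h_9) = 1 mod 4; and T(h_9) <> 1 because
    Dic_12 is not abelian. Therefore T(h_x) = 5^x, and S(h_x) = u^x with
    u = S(h_9), since S kills the commutator h_4 ([brace_classification]).

    Finally [dic_brace u] and [dic_brace v] are isomorphic exactly when u and v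
    have the same order ([dic_brace_isoP]): an isomorphism is diagonal, say
    (a, x) |-> (c a, d x) with d odd, and comparing products gives u = v^d;
    conversely (a, x) |-> (a, - x) replaces u by its inverse. The units of Z_p
    form a cyclic group of order p - 1, so the orders to consider are the
    common divisors of 4 and p - 1, and the kernel of x |-> u^x has order 12
    divided by the order of u. *)

Set Implicit Arguments.
Unset Strict Implicit.
Unset Printing Implicit Defensive.

Import GRing.Theory.

Local Open Scope ring_scope.

(** * Exhaustive verification over Z_12 *)

(** The enumeration of a finite type does not reduce; this one does, so that
    identities over Z_12 are checked by evaluation. *)
Definition enumZ12 : seq 'Z_12 := [seq inZp i | i <- iota 0 12].

Lemma Z12_all (P : pred 'Z_12) : all P enumZ12 -> forall x, P x.
Proof.
move=> /allP allP x; apply: allP; apply/mapP; exists (x : nat).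
  by rewrite mem_iota /= ltn_ord.
by apply: val_inj; rewrite /= modn_small ?ltn_ord.
Qed.

Lemma Z12_all2 (P : 'Z_12 -> pred 'Z_12) :
  all (fun x => all (P x) enumZ12) enumZ12 -> forall x y, P x y.
Proof. by move=> allP x; apply/Z12_all; move: x; apply: Z12_all. Qed.

(** * The brace on Z_12 with dicyclic multiplicative group *)

(** 5 is 1 modulo 4 and -1 modulo 3: odd elements invert the 3-part of Z_12 and
    fix its 2-part. *)
Definition twist (x : 'Z_12) : 'Z_12 := 5%:R ^+ x.
Definition circ (x y : 'Z_12) : 'Z_12 := x + twist x * y.
Definition circV (x : 'Z_12) : 'Z_12 := - (twist x * x).

Lemma twistM x y : twist (circ x y) = twist x * twist y.
Proof. by apply/eqP; move: x y; apply: Z12_all2; vm_compute. Qed.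

Lemma twistK x : twist x * twist x = 1.
Proof. by apply/eqP; move: x; apply: Z12_all; vm_compute. Qed.

Lemma circA : associative circ.
Proof. by move=> x y z; rewrite {1 3 4}/circ twistM /circ mulrDr mulrA addrA. Qed.

Lemma circ0x : left_id 0 circ.
Proof. by move=> x; rewrite /circ /twist expr0 mul1r add0r. Qed.

Lemma circx0 : right_id 0 circ.
Proof. by move=> x; rewrite /circ mulr0 addr0. Qed.

Lemma circVx : left_inverse 0 circV circ.
Proof. by move=> x; apply/eqP; move: x; apply: Z12_all; vm_compute. Qed.

Lemma circxV : right_inverse 0 circV circ.
Proof. by move=> x; rewrite /circ mulrN mulrA twistK mul1r subrr. Qed.

Definition dic := 'Z_12.

HB.instance Definition _ := Finite.on dic.
HB.instance Definition _ := GRing.Zmodule.on dic.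
HB.instance Definition _ := isGroup.Build dic circA circ0x circx0 circVx circxV.

Fact dic_braceDr (a b c : dic) : (a * (b + c)%R)%g = (a * b)%g - a + (a * c)%g.
Proof.
by rewrite /mulg /= /circ mulrDr addrA [X in X - a]addrC addrK [RHS]addrCA addrA.
Qed.

HB.instance Definition _ := isLeftBrace.Build dic dic_braceDr.

(** The quotient of dic by its 3-part is additive, and cyclic of order 4. *)
Lemma dic_mul_mod4 (z w : dic) : ((z * w)%g = z + w %[mod 4])%N.
Proof. by apply/eqP; move: z w; apply: Z12_all2; vm_compute. Qed.

Lemma dic_mul_mod3 (z w : dic) : ((z * w)%g = z + 2 ^ z * w %[mod 3])%N.
Proof. by apply/eqP; move: z w; apply: Z12_all2; vm_compute. Qed.

Lemma dic_involution_unique (x y : dic) :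
  (x * x = 1 -> y * y = 1 -> [|| x == 1, y == 1 | x == y])%g.
Proof.
have check : forall z w : dic,
    (((z * z == 1) && (w * w == 1)) ==> [|| z == 1, w == 1 | z == w])%g.
  by apply: Z12_all2; vm_compute.
by move=> xx yy; apply: (implyP (check x y)); rewrite xx yy !eqxx.
Qed.

Lemma dic_noncommutative : exists x y : dic, (x * y != y * x)%g.
Proof. by exists (inZp 1 : 'Z_12), (inZp 4 : 'Z_12); vm_compute. Qed.

Section DicPresentation.
Local Open Scope group_scope.
Variables (gT : finGroupType) (x y : gT).
Hypotheses (x3 : x ^+ 3 = 1) (y4 : y ^+ 4 = 1) (yx : y * x * y^-1 = x ^+ 2).

Lemma mulX_exp2 m n : y ^+ m * x ^+ n = x ^+ (2 ^ m * n) * y ^+ m.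
Proof.
have step k : y * x ^+ k = x ^+ (2 * k) * y.
  elim: k => [|k IHk]; first by rewrite mulg1 mul1g.
  by rewrite expgS mulgA -[y * x](mulgKV y) yx -mulgA IHk mulgA -expgD mulnS.
elim: m n => [|m IHm] n; first by rewrite !expg0 expn0 mul1n mulg1 mul1g.
by rewrite expgS -mulgA IHm mulgA step -mulgA mulnA expnS.
Qed.

(** In [dic], z is 4^z 9^z: the power of 4 is the 3-part of z, the power of 9
    its 2-part. So the morphism sending 4 to x and 9 to y has this formula. *)
Definition dic_lift (z : dic) : gT := x ^+ (z : 'Z_12) * y ^+ (z : 'Z_12).

Lemma dic_liftM : {morph dic_lift : z w / z * w}.
Proof.
move=> z w; rewrite /dic_lift -(expg_mod _ x3) -(expg_mod _ y4).
rewrite dic_mul_mod3 dic_mul_mod4 (expg_mod _ x3) (expg_mod _ y4).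
rewrite !expgD !mulgA; congr (_ * _).
by rewrite -!mulgA; congr (_ * _); rewrite mulX_exp2.
Qed.

Lemma joing_homg_dic : <[x]> <*> <[y]> \homg [set: dic].
Proof.
have liftM : {in [set: dic] &, {morph dic_lift : z w / z * w}}.
  by move=> z w _ _; apply: dic_liftM.
apply/homgP; exists (Morphism liftM); apply/eqP; rewrite eqEsubset.
apply/andP; split.
  apply/subsetP=> _ /morphimP[z _ _ ->] /=.
  by apply: groupM; apply: groupX; apply: mem_gen; rewrite inE cycle_id ?orbT.
rewrite join_subG !cycle_subG; apply/andP; split; apply/morphimP.
  exists (inZp 4 : 'Z_12); rewrite ?inE //= /dic_lift /=.
  by rewrite y4 mulg1 expgS x3 mulg1.
exists (inZp 9 : 'Z_12); rewrite ?inE //= /dic_lift /=.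
by rewrite (expgM x 3 3) x3 expg1n mul1g (expgD y 4 5) (expgD y 4 1) y4 !mul1g.
Qed.

End DicPresentation.

Lemma dic_is_Dic12 : is_Dic12 dic.
Proof.
apply: intro_isoGrp => [|rT H].
  have [x [y [x3 y4 yx gen]]] : exists x y : dic,
      [/\ x ^+ 3 == 1, y ^+ 4 == 1, y * x * y^-1 == x ^+ 2
        & forall z : dic, z == x ^+ z * y ^+ z]%g.
    exists (inZp 4 : 'Z_12), (inZp 9 : 'Z_12); split; [by vm_compute.. |].
    by apply: Z12_all; vm_compute.
  apply/existsP; exists (x, y); rewrite /= !xpair_eqE /= x3 y4 yx !andbT.
  rewrite eqEsubset subsetT; apply/subsetP=> z _; rewrite (eqP (gen z)).
  by apply: groupM; apply: groupX; apply: mem_gen; rewrite inE cycle_id ?orbT.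
case/existsP=> -[x y] /=; rewrite /= !xpair_eqE /=.
by case/and4P=> /eqP <- /eqP x3 /eqP y4 /eqP yx; apply: joing_homg_dic.
Qed.

(** Two groups with the same presentation are images of each other; being finite,
    they are isomorphic. *)
Lemma is_Dic12_isog (D : finGroupType) : is_Dic12 D -> [set: D] \isog [set: dic].
Proof.
move=> DicD; rewrite isogEhom.
rewrite (dic_is_Dic12 [set: D]) -(DicD D [set: D]%G) homg_refl.
by rewrite (DicD dic [set: dic]%G) -(dic_is_Dic12 [set: dic]%G) homg_refl.
Qed.

(** * Additive endomorphisms of Z_p x Z_12 *)

Section CoprimeEndo.
Variables (p : nat) (p_prime : prime p) (p_ge7 : (7 <= p)%N).

Lemma p_coprime12 : coprime p 12.
Proof.
rewrite prime_coprime //; apply/negP=> p_dvd.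
have : p \in primes 12 by rewrite mem_primes p_prime.
by rewrite !inE => /orP[] /eqP p_eq; move: (p_ge7); rewrite p_eq.
Qed.

Lemma Z12_mulrn_p (x : 'Z_12) : x *+ p = 0 -> x = 0.
Proof.
rewrite -mulr_natr => /eqP xp0; apply/eqP.
rewrite -(@mulIr_eq0 _ p%:R) //; apply: mulIr.
by rewrite unitZpE // coprime_sym p_coprime12.
Qed.

Lemma Fp_mulrn12 (a : 'F_p) : a *+ 12 = 0 -> a = 0.
Proof.
move/eqP; rewrite -mulr_natr mulf_eq0 -(dvdn_pcharf (pchar_Fp p_prime)).
have := p_coprime12; rewrite prime_coprime // => /negPf ->.
by rewrite orbF => /eqP.
Qed.

Lemma Fp_natr_p : p%:R = 0 :> 'F_p.
Proof. by apply/eqP; rewrite -(dvdn_pcharf (pchar_Fp p_prime)). Qed.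

(** The off-diagonal components are additive maps between groups of coprime
    orders, hence zero. *)
Lemma additive_diag (f : 'F_p * 'Z_12 -> 'F_p * 'Z_12) :
    {morph f : z w / z + w} ->
  forall a x, f (a, x) = ((f (1, 0)).1 * a, (f (0, 1)).2 * x).
Proof.
move=> fD; have f0 : f 0 = 0 by apply: (@addrI _ (f 0)); rewrite -fD !addr0.
have fX z n : f (z *+ n) = f z *+ n.
  by elim: n => [|n IHn]; rewrite ?mulr0n // !mulrS fD IHn.
have pairX (U V : zmodType) (v : U * V) n : v *+ n = (v.1 *+ n, v.2 *+ n).
  by elim: n => [|n IHn]; rewrite ?mulr0n // !mulrS IHn.
move=> a x; have {1}-> : (a, x) = (1, 0) *+ a + (0, 1) *+ x :> 'F_p * 'Z_12.
  by rewrite !pairX /= !mul0rn; congr (_, _); rewrite ?addr0 ?add0r natr_Zp.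
have f10 : (f (1, 0)).2 = 0.
  apply: Z12_mulrn_p.
  have -> : (f (1, 0)).2 *+ p = (f (1, 0) *+ p).2 by rewrite pairX.
  by rewrite -fX pairX /= mul0rn Fp_natr_p f0.
have f01 : (f (0, 1)).1 = 0.
  apply: Fp_mulrn12.
  have -> : (f (0, 1)).1 *+ 12 = (f (0, 1) *+ 12).1 by rewrite pairX.
  rewrite -fX pairX /= mul0rn.
  have -> : 12%:R = 0 :> 'Z_12 by apply/eqP.
  by rewrite f0.
rewrite fD !fX !pairX; congr (_, _) => /=.
  by rewrite f01 mul0rn addr0 -{2}[a]natr_Zp mulr_natr.
by rewrite f10 mul0rn add0r -{2}[x]natr_Zp mulr_natr.
Qed.

End CoprimeEndo.

(** * Generalities on left braces *)

Lemma brace_iso_refl (B : leftBraceType) : brace_iso B B.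
Proof. by exists id; split=> //; exists id. Qed.

Lemma brace_iso_sym (B1 B2 : leftBraceType) : brace_iso B1 B2 -> brace_iso B2 B1.
Proof.
case=> f [[g fK gK] fD fM]; exists g; split; first by exists f.
  by move=> a b; apply: (can_inj fK); rewrite fD !gK.
by move=> a b; apply: (can_inj fK); rewrite fM !gK.
Qed.

Lemma brace_iso_trans (B1 B2 B3 : leftBraceType) :
  brace_iso B1 B2 -> brace_iso B2 B3 -> brace_iso B1 B3.
Proof.
case=> f [f_bij fD fM] [g [g_bij gD gM]]; exists (g \o f).
by split=> [|a b|a b] /=; [apply: bij_comp | rewrite fD gD | rewrite fM gM].
Qed.

Lemma brace_one_eq0 (B : leftBraceType) : (1%g : B) = 0.
Proof.
have := brace_mulgDr (1%g : B) 0 0.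
rewrite addr0 mul1g add0r addr0 => /eqP.
by rewrite eq_sym oppr_eq0 => /eqP.
Qed.

(** * The braces Z_p x| dic *)

Section DicBraces.
Variable p : nat.
Implicit Types u v : {unit 'F_p}.

Definition dic_char u of (u ^+ 4 = 1)%g := fun z : dic => (u ^+ (z : 'Z_12))%g.

Fact dic_charM u (u4 : (u ^+ 4 = 1)%g) :
  {morph dic_char u4 : z w / (z * w)%g >-> (z * w)%g}.
Proof.
move=> z w; rewrite /dic_char -(expg_mod _ u4) dic_mul_mod4.
by rewrite (expg_mod _ u4) expgD.
Qed.

HB.instance Definition _ u (u4 : (u ^+ 4 = 1)%g) :=
  isMultiplicative.Build dic {unit 'F_p} (dic_char u4) (dic_charM u4).

Definition dic_brace u (u4 : (u ^+ 4 = 1)%g) : leftBraceType :=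
  semidirect (dic_char u4).

Lemma dic_brace_mulE u (u4 : (u ^+ 4 = 1)%g) a b (x y : 'Z_12) :
  @mulg (dic_brace u4) (a, x) (b, y) = (a + val (u ^+ x)%g * b, circ x y).
Proof. by []. Qed.

Lemma dic_brace_C12_Dic12 u (u4 : (u ^+ 4 = 1)%g) :
  C12_Dic12_brace p (dic_brace u4).
Proof.
split; first by exists id; split=> //; exists id.
exists dic; first exact: dic_is_Dic12.
by exists (dic_char u4); exists id; split=> //; exists id.
Qed.

Lemma has_order_card (T : finType) n : #|T| = n -> has_order T n.
Proof. by move=> <-; exists enum_val; apply: enum_val_bij. Qed.

Lemma dic_order : has_order dic 12.
Proof. by apply: has_order_card; rewrite card_ord. Qed.

(** The kernel of x |-> u^x is the set of multiples of the order of u. *)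
Lemma dic_brace_kernel u (u4 : (u ^+ 4 = 1)%g) :
  has_kernel_of_order p (dic_brace u4) (12 %/ #[u]%g)%N.
Proof.
exists dic, (dic_char u4); split; first exact: dic_order.
  exact: brace_iso_refl.
apply: has_order_card; rewrite card_sig.
have uz (z : dic) : (dic_char u4 z == 1%g) = (#[u]%g %| (z : 'Z_12))%N.
  by rewrite order_dvdn.
have /dvdn_leq : (#[u]%g %| 4)%N by rewrite order_dvdn u4.
have := u4 => /eqP; rewrite -order_dvdn (eq_card uz).
rewrite -sum1_card big_mkcond /=.
by move: #[u]%g => [|[|[|[|[|n]]]]] // _ _; rewrite !big_ord_recl big_ord0.
Qed.

(** x |-> - x is an automorphism of the brace [dic], and it turns the character
    of u into that of its inverse. *)
Lemma dic_brace_inv_iso u (u4 : (u ^+ 4 = 1)%g) (v4 : (u^-1 ^+ 4 = 1)%g) :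
  brace_iso (dic_brace u4) (dic_brace v4).
Proof.
have opp4 (z : 'Z_12) : (- z + z = 0 %[mod 4])%N.
  by apply/eqP; move: z; apply: Z12_all; vm_compute.
have charV z : dic_char v4 (- z) = dic_char u4 z.
  rewrite /dic_char expVgn; apply: (mulgI (u ^+ (- z : 'Z_12))%g).
  by rewrite mulgV -expgD -(expg_mod _ u4) opp4.
have oppM (z w : dic) : - (z * w)%g = ((- z : dic) * (- w))%g.
  by apply/eqP; move: z w; apply: Z12_all2; vm_compute.
exists (fun z => (z.1, - z.2)); split.
- by exists (fun z => (z.1, - z.2)) => -[a z]; rewrite /= opprK.
- by case=> a z [b w]; congr (_, _); rewrite /= opprD.
by case=> a z [b w]; congr (_, _); rewrite /= ?charV ?oppM.
Qed.

Hypotheses (p_prime : prime p) (p_ge7 : (7 <= p)%N).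

(** The isomorphism is (a, x) |-> (c a, d x) with c and d invertible; its
    value at (0, 1) * (1, 0) = (u, 1) shows that u = v^d. *)
Lemma dic_brace_iso_eqVinv u v (u4 : (u ^+ 4 = 1)%g) (v4 : (v ^+ 4 = 1)%g) :
  brace_iso (dic_brace u4) (dic_brace v4) -> u = v \/ u = (v^-1)%g.
Proof.
case=> f [[g fK gK] fD fM].
have := additive_diag p_prime p_ge7 fD; set c := (f _).1; set d := (f _).2 => fE.
have c_neq0 : c != 0.
  apply/eqP=> c0; have /(_ (1, 0) 0) := can_inj fK.
  rewrite !fE c0 !mul0r => /(_ erefl) [] /eqP.
  by rewrite oner_eq0.
have u_vd : u = (v ^+ (d : 'Z_12))%g.
  apply: val_inj; apply: (mulfI c_neq0); rewrite [RHS]mulrC.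
  have := congr1 fst (fM (0, 1) (1, 0)); rewrite !dic_brace_mulE !fE /=.
  by rewrite !mulr0 !add0r !mulr1.
have d_odd : (d == 1 %[mod 4]) || (d == 3 %[mod 4]).
  have unit_odd (e x : 'Z_12) :
      (e * x == 1) ==> (e == 1 %[mod 4]) || (e == 3 %[mod 4]).
    by move: e x; apply: Z12_all2; vm_compute.
  apply: (implyP (unit_odd d (g (0, 1)).2)).
  have := gK (0, 1); case: (g _) => a x; rewrite fE => /(congr1 snd) /= dx1.
  by apply/eqP.
rewrite u_vd -(expg_mod _ v4); case/orP: d_odd => /eqP ->; first by left.
by right; apply: (mulgI v); rewrite mulgV -expgS.
Qed.

(** Subgroups of the cyclic group of units with the same order coincide, and a
    cyclic group of order 1, 2 or 4 has no generators but v and its inverse. *)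
Lemma eq_order_eqVinv u v :
  (v ^+ 4 = 1)%g -> #[u]%g = #[v]%g -> u = v \/ u = v^-1%g.
Proof.
move=> v4 ouv; have cyc := field_unit_group_cyclic [set: {unit 'F_p}].
have cycle_eq : <[u]>%g = <[v]>%g.
  by apply/eqP; rewrite (eq_subG_cyclic cyc) ?subsetT // -!orderE ouv.
have /cyclePmin[i i_lt u_vi] : u \in <[v]>%g by rewrite -cycle_eq cycle_id.
have od4 : (#[v]%g %| 4)%N by rewrite order_dvdn v4.
have ov4 := dvdn_leq (isT : 0 < 4)%N od4.
have i_lt4 := leq_trans i_lt ov4.
move: ouv i_lt; rewrite {1}u_vi orderXgcd u_vi.
case: i {u_vi} i_lt4 => [|[|[|[|]]]] //= _.
- rewrite gcdn0 divnn order_gt0 => /esym/eqP; rewrite order_eq1 => /eqP -> _.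
  by left.
- by left.
- by case: #[v]%g od4 ov4 => [|[|[|[|[|]]]]].
- by right; apply: (mulgI v); rewrite mulgV -expgS.
Qed.

Lemma dic_brace_isoP u v (u4 : (u ^+ 4 = 1)%g) (v4 : (v ^+ 4 = 1)%g) :
  brace_iso (dic_brace u4) (dic_brace v4) <-> #[u]%g = #[v]%g.
Proof.
split=> [/dic_brace_iso_eqVinv[] -> // | ouv]; first by rewrite orderV.
case: (eq_order_eqVinv v4 ouv) => uv; subst u.
  by rewrite (eq_irrelevance u4 v4); apply: brace_iso_refl.
exact/brace_iso_sym/dic_brace_inv_iso.
Qed.

End DicBraces.

(** * Structure of a brace with additive group Z_p x Z_12 *)

Section BraceStructure.
Variables (p : nat) (p_prime : prime p) (p_ge7 : (7 <= p)%N).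
Variables (C : leftBraceType) (phi : C -> 'F_p * 'Z_12).
Variable psi : 'F_p * 'Z_12 -> C.
Hypotheses (phiK : cancel phi psi) (psiK : cancel psi phi).
Hypothesis phiD : {morph phi : u v / u + v}.

Local Notation lambda u v := (@mulg C u v - u).

(** The diagonal entries of the additive map lambda_u, read on the generators
    of Z_p and Z_12. *)
Definition actFp (u : C) : 'F_p := (phi (lambda u (psi (1, 0)))).1.
Definition actZ12 (u : C) : 'Z_12 := (phi (lambda u (psi (0, 1)))).2.

Local Notation S := actFp.
Local Notation T := actZ12.

Lemma psiD : {morph psi : z w / z + w}.
Proof. by move=> z w; apply: (can_inj phiK); rewrite phiD !psiK. Qed.

Lemma phi_mul u v :
  phi (u * v)%g = ((phi u).1 + S u * (phi v).1, (phi u).2 + T u * (phi v).2).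
Proof.
have lamD : {morph (fun z => phi (lambda u (psi z))) : z w / z + w}.
  by move=> z w; rewrite psiD brace_mulgDr -phiD -addrA.
have := additive_diag p_prime p_ge7 lamD (phi v).1 (phi v).2.
rewrite -surjective_pairing phiK => lamE.
have -> : (u * v)%g = u + lambda u v by rewrite addrC subrK.
by rewrite phiD lamE; case: (phi u) => a x; congr (_, _).
Qed.

Lemma phi1 : phi 1%g = 0.
Proof.
by rewrite brace_one_eq0; apply: (@addrI _ (phi 0)); rewrite -phiD !addr0.
Qed.

Lemma actFp1 : S 1%g = 1.
Proof.
have := congr1 fst (phi_mul 1%g (psi (1, 0))).
by rewrite mul1g psiK phi1 /= add0r mulr1.
Qed.

Lemma actZ12_1 : T 1%g = 1.
Proof.
have := congr1 snd (phi_mul 1%g (psi (0, 1))).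
by rewrite mul1g psiK phi1 /= add0r mulr1.
Qed.

Lemma actFpM : {morph S : u v / (u * v)%g >-> u * v}.
Proof.
move=> u v; have := congr1 phi (mulgA u v (psi (1, 0))%R).
rewrite !phi_mul psiK => /(congr1 fst) /=.
by rewrite !mulr1 mulrDr addrA => /addrI.
Qed.

Lemma actZ12M : {morph T : u v / (u * v)%g >-> u * v}.
Proof.
move=> u v; have := congr1 phi (mulgA u v (psi (0, 1))%R).
rewrite !phi_mul psiK => /(congr1 snd) /=.
by rewrite !mulr1 mulrDr addrA => /addrI.
Qed.

Lemma actFpX u n : S (u ^+ n)%g = S u ^+ n.
Proof. by elim: n => [|n IHn]; rewrite ?actFp1 // expgS actFpM IHn exprS. Qed.

Lemma actZ12X u n : T (u ^+ n)%g = T u ^+ n.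
Proof. by elim: n => [|n IHn]; rewrite ?actZ12_1 // expgS actZ12M IHn exprS. Qed.

Lemma actFp_neq0 u : S u != 0.
Proof.
apply/eqP=> Su0; have := actFpM u u^-1%g; rewrite mulgV actFp1 Su0 mul0r => /eqP.
by rewrite oner_eq0.
Qed.

(** The units of Z_12 are 1, 5, 7 and 11, of exponent 2. *)
Lemma actZ12_sqr u : T u * T u = 1.
Proof.
have unit_sqr (x y : 'Z_12) : (x * y == 1) ==> (x * x == 1).
  by move: x y; apply: Z12_all2; vm_compute.
apply/eqP; apply: implyP (unit_sqr (T u) (T u^-1%g)) _.
by rewrite -actZ12M mulgV actZ12_1.
Qed.

(** Otherwise left multiplication by (a, 0) would fix the element whose
    Z_p-coordinate solves a + S(u) b = b. *)
Lemma actFp_pPart a : S (psi (a, 0)) = 1.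
Proof.
set u := psi (a, 0); have [//|Su] := eqVneq (S u) 1.
have Su' : 1 - S u != 0 by rewrite subr_eq0 eq_sym.
suff -> : u = 1%g by rewrite actFp1.
apply: (mulIg (psi (a / (1 - S u), 0))); rewrite mul1g.
apply: (can_inj phiK); rewrite phi_mul !psiK /= mulr0 addr0.
congr (_, _); rewrite mulrCA -{1}[a]mulr1 -mulrDr; congr (_ * _).
by apply: (mulIf Su'); rewrite mulrDl mulfVK // mul1r subrK mulVf.
Qed.

(** (a, 0) is the square of (a / 2, 0). *)
Lemma actZ12_pPart a : T (psi (a, 0)) = 1.
Proof.
have two_neq0 : 2%:R != 0 :> 'F_p.
  by rewrite -(dvdn_pcharf (pchar_Fp p_prime)) gtnNdvd // (leq_trans _ p_ge7).
pose b := a / 2%:R; have -> : psi (a, 0) = (psi (b, 0) * psi (b, 0))%g.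
  apply: (can_inj phiK); rewrite phi_mul !psiK /= actFp_pPart mul1r mulr0 addr0.
  by rewrite -mulr2n -mulr_natr mulfVK.
by rewrite actZ12M actZ12_sqr.
Qed.

(** The additive Hall subgroup of order 12: it is stable under every lambda_u,
    hence closed under products too. *)
Definition hall (x : 'Z_12) : C := psi (0, x).

Local Notation h := hall.
Local Notation t x := (T (h x)).

Lemma psi_split a x : psi (a, x) = (psi (a, 0) * h x)%g.
Proof.
apply: (can_inj phiK); rewrite phi_mul /h !psiK /= actZ12_pPart mulr0 addr0.
by rewrite mul1r add0r.
Qed.

Lemma actFp_psi a x : S (psi (a, x)) = S (h x).
Proof. by rewrite psi_split actFpM actFp_pPart mul1r. Qed.

Lemma actZ12_psi a x : T (psi (a, x)) = t x.
Proof. by rewrite psi_split actZ12M actZ12_pPart mul1r. Qed.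

Lemma hallM x y : (h x * h y = h (x + t x * y)%R)%g.
Proof. by apply: (can_inj phiK); rewrite phi_mul /h !psiK /= mulr0 addr0. Qed.

Lemma hall0 : h 0 = 1%g.
Proof. by apply: (can_inj phiK); rewrite /h psiK phi1. Qed.

Lemma hall_inj : injective h.
Proof. by move=> x y /(congr1 phi); rewrite /h !psiK => -[]. Qed.

Lemma hallX x n : t x * x = x -> (h x ^+ n = h (x *+ n)%R)%g.
Proof.
move=> tx; elim: n => [|n IHn]; first by rewrite expg0 mulr0n hall0.
by rewrite expgS IHn hallM mulrnAr tx mulrS.
Qed.

(** The square of h_x is h_(x + t x) with t = T(h_x); it acts trivially on
    Z_12, so its powers are computed additively, and 6 (1 + t) = 0. *)
Lemma hall_exp12 x : (h x ^+ 12 = 1)%g.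
Proof.
have sqr_even (r y : 'Z_12) : (r * r == 1) ==> ((y + r * y) *+ 6 == 0).
  by move: r y; apply: Z12_all2; vm_compute.
rewrite (expgM _ 2 6) expg2 hallM hallX; last first.
  by rewrite -hallM actZ12M actZ12_sqr mul1r.
by rewrite (eqP (implyP (sqr_even _ x) (introT eqP (actZ12_sqr _)))) hall0.
Qed.

(** If T(h_4) does not fix 4 then 4 + T(h_4) 8 = 8, so h_4 h_8 = h_8. *)
Lemma actZ12_hall4_fix : t (inZp 4) * inZp 4 = inZp 4.
Proof.
have r4 (r : 'Z_12) : (r * r == 1) ==>
    (r * inZp 4 == inZp 4) || (inZp 4 + r * inZp 8 == inZp 8).
  by move: r; apply: Z12_all; vm_compute.
case/orP: (implyP (r4 _) (introT eqP (actZ12_sqr (h (inZp 4))))) => /eqP // bad.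
have /hall_inj // : h (inZp 4) = h 0.
by apply: (mulIg (h (inZp 8))); rewrite hallM bad hall0 mul1g.
Qed.

(** h_4 is its own fourth power, and the values of T square to 1. *)
Lemma actZ12_hall4 : t (inZp 4) = 1.
Proof.
have <- : (inZp 4 : 'Z_12) *+ 4 = inZp 4 by apply/eqP; vm_compute.
rewrite -hallX ?actZ12_hall4_fix // (expgM _ 2 2) !expg2 !actZ12M !actZ12_sqr.
by rewrite mulr1.
Qed.

(** gam stands for the projection of the multiplicative group Z_p x| Dic_12 of C
    onto Dic_12. *)
Variable gam : C -> dic.
Hypothesis gamM : {morph gam : u v / (u * v)%g}.
Hypothesis gam_ker : forall u, gam u = 1%g -> (u ^+ p = 1)%g.

Lemma gam1 : gam 1%g = 1%g.
Proof. by apply: (mulIg (gam 1%g)); rewrite -gamM !mul1g. Qed.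

(** An element of the kernel has exponent p, an element h_z exponent 12. *)
Lemma gam_hall_inj : injective (fun x => gam (h x)).
Proof.
move=> x y gxy; pose z := t x * (y - x).
have hxz : (h x * h z = h y)%g.
  by rewrite hallM /z mulrA actZ12_sqr mul1r addrC subrK.
have gz1 : gam (h z) = 1%g.
  by apply: (mulgI (gam (h x))); rewrite -gamM hxz mulg1 gxy.
have [a _] := Bezoutl 12 (prime_gt0 p_prime).
rewrite (eqP (p_coprime12 p_prime p_ge7)) => /dvdnP[b eq_ab].
have : (h z ^+ (1 + a * 12) = 1)%g.
  by rewrite eq_ab mulnC expgM gam_ker ?expg1n.
rewrite expgD mulnC expgM hall_exp12 expg1n mulg1 expg1 => hz1.
by apply: hall_inj; rewrite -hxz hz1 mulg1.
Qed.

(** Otherwise h_9 would be an involution, as h_6 always is, and their images in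
    Dic_12 would be distinct. *)
Lemma actZ12_hall9_fix : t (inZp 9) * inZp 9 = inZp 9.
Proof.
have r9 (r : 'Z_12) : (r * r == 1) ==>
    ((r * inZp 9 == inZp 9) || (inZp 9 + r * inZp 9 == 0))
      && (inZp 6 + r * inZp 6 == 0).
  by move: r; apply: Z12_all; vm_compute.
have rP x := implyP (r9 _) (introT eqP (actZ12_sqr (h x))).
case/andP: (rP (inZp 9)) => /orP[/eqP // | /eqP h99] _.
have /andP[_ /eqP h66] := rP (inZp 6).
have gamhh x : x + t x * x = 0 -> (gam (h x) * gam (h x) = 1)%g.
  by move=> hx; rewrite -gamM hallM hx hall0 gam1.
have := dic_involution_unique (gamhh _ h99) (gamhh _ h66).
by rewrite -gam1 -hall0 !(inj_eq gam_hall_inj).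
Qed.

(** The additive decomposition x = 4x + 9x of Z_12 is also multiplicative,
    since h_4 acts trivially and h_9 fixes 9. *)
Lemma hall_gen x : (h x = h (inZp 4) ^+ (x : nat) * h (inZp 9) ^+ (x : nat))%g.
Proof.
rewrite (hallX _ actZ12_hall4_fix) (hallX _ actZ12_hall9_fix) hallM.
rewrite -(hallX _ actZ12_hall4_fix) actZ12X actZ12_hall4 expr1n mul1r.
by congr h; apply/eqP; rewrite eq_sym; move: x; apply: Z12_all; vm_compute.
Qed.

(** The other unit fixing 9 is 1; with it, T would be trivial on the complement,
    whose image Dic_12 would be abelian. *)
Lemma actZ12_hall9 : t (inZp 9) = 5%:R.
Proof.
have r9 (r : 'Z_12) :
    (r * r == 1) && (r * inZp 9 == inZp 9) ==> (r == 1) || (r == 5%:R).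
  by move: r; apply: Z12_all; vm_compute.
have := implyP (r9 (t (inZp 9))).
rewrite actZ12_hall9_fix actZ12_sqr !eqxx => /(_ isT) /orP[] /eqP // t9_1.
have t1 x : t x = 1.
  by rewrite hall_gen actZ12M !actZ12X actZ12_hall4 t9_1 !expr1n mulr1.
have [g gamK gK] := injF_bij gam_hall_inj.
have [x [y /eqP[]]] := dic_noncommutative.
by rewrite -(gK x) -(gK y) -!gamM !hallM !t1 !mul1r addrC.
Qed.

Lemma actZ12_hall x : t x = twist x.
Proof.
by rewrite hall_gen actZ12M !actZ12X actZ12_hall4 actZ12_hall9 expr1n mul1r.
Qed.

(** h_9 h_4 = h_5 = h_8 h_9 = (h_4)^2 h_9, and S has commutative values. *)
Lemma actFp_hall4 : S (h (inZp 4)) = 1.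
Proof.
have := hallM (inZp 9) (inZp 4); rewrite actZ12_hall9.
have -> : inZp 9 + 5%:R * inZp 4 = inZp 8 + inZp 9 :> 'Z_12.
  by apply/eqP; vm_compute.
have := hallM (inZp 8) (inZp 9); rewrite actZ12_hall.
have -> : twist (inZp 8) = 1 by apply/eqP; vm_compute.
rewrite mul1r => <- /(congr1 S); rewrite !actFpM.
have -> : inZp 8 = inZp 4 *+ 2 :> 'Z_12 by apply/eqP; vm_compute.
rewrite -(hallX _ actZ12_hall4_fix) actFpX mulrC => /(mulIf (actFp_neq0 _)).
by rewrite expr2 -{1}[S _]mulr1 => /(mulfI (actFp_neq0 _)) <-.
Qed.

Lemma actFp_hall x : S (h x) = S (h (inZp 9)) ^+ x.
Proof. by rewrite hall_gen actFpM !actFpX actFp_hall4 expr1n mul1r. Qed.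

Lemma brace_classification :
  exists (u : {unit 'F_p}) (u4 : (u ^+ 4 = 1)%g), brace_iso C (dic_brace u4).
Proof.
have s9_unit : S (h (inZp 9)) \is a GRing.unit by rewrite unitfE actFp_neq0.
pose u := FinRing.unit _ s9_unit.
have uX n : val (u ^+ n)%g = S (h (inZp 9)) ^+ n.
  by elim: n => [|n IHn]; rewrite ?expg0 // expgS exprS -IHn.
have u4 : (u ^+ 4 = 1)%g.
  apply: val_inj; rewrite uX -actFpX (hallX _ actZ12_hall9_fix).
  have -> : inZp 9 *+ 4 = 0 :> 'Z_12 by apply/eqP; vm_compute.
  by rewrite hall0 actFp1.
exists u, u4, phi; split=> //; first by exists psi.
move=> v w; rewrite phi_mul [phi v]surjective_pairing [phi w]surjective_pairing.
rewrite dic_brace_mulE uX -actFp_hall /circ -actZ12_hall.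
by rewrite -(actFp_psi (phi v).1) -(actZ12_psi (phi v).1) -surjective_pairing phiK.
Qed.

End BraceStructure.

(** * Classification *)

Section Classification.
Variables (p : nat) (p_prime : prime p) (p_ge7 : (7 <= p)%N).
Implicit Types u v : {unit 'F_p}.

(** The kernel of the projection onto Dic_12 consists of the pairs (a, 1), whose
    p-th power is (p a, 1) = 1. *)
Lemma C12_Dic12_brace_dic_brace (C : leftBraceType) :
    C12_Dic12_brace p C ->
  exists u (u4 : (u ^+ 4 = 1)%g), brace_iso C (dic_brace u4).
Proof.
case=> -[phi [[psi phiK psiK] phiD]] [D DicD [tau [m [[m' mK m'K] mM]]]].
have [f f_inj _] := isogP (is_Dic12_isog DicD).
apply: (brace_classification p_prime p_ge7 phiK psiK phiD
          (gam := fun w => f (m w).2)).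
  by move=> u v; rewrite mM /= morphM ?inE.
move=> u; rewrite -(morph1 f) => /(injmP f_inj); rewrite !inE => /(_ isT isT) mu2.
have m1 : m 1%g = 1%g by apply: (mulIg (m 1%g)); rewrite -mM !mul1g.
have mX n : m (u ^+ n)%g = ((m u).1 *+ n, 1%g) :> 'F_p * D.
  elim: n => [|n IHn]; first by rewrite m1.
  rewrite expgS mM IHn; congr (_, _); rewrite /= mu2 ?mul1g //.
  by rewrite tau1 FinRing.val_unit1 mul1r mulrS.
by apply: (can_inj mK); rewrite mX m1 -mulr_natr Fp_natr_p // mulr0.
Qed.

Lemma card_Fp_unit : #|[set: {unit 'F_p}]| = p.-1.
Proof. by rewrite card_finField_unit card_Fp. Qed.

(** The order of u is 2^i for some i <= 2; it exists exactly when it divides the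
    order p - 1 of the cyclic group of units. *)
Lemma dic_braces_up_to_iso n : (n < 3)%N ->
    (forall i : 'I_3, (2 ^ i %| p.-1)%N = (i <= n)%N) ->
  exists B : 'I_n.+1 -> leftBraceType,
    [/\ classifies (C12_Dic12_brace p) B, is_direct_product p (B 0)
      & forall i, has_kernel_of_order p (B i) (12 %/ 2 ^ i)%N].
Proof.
move=> n_lt3 dvd_p; have n_le (i : 'I_n.+1) : (i < 3)%N.
  by apply: leq_trans (ltn_ord i) _.
have dvd_p1 (i : 'I_n.+1) : (2 ^ i %| p.-1)%N.
  by rewrite (dvd_p (Ordinal (n_le i))) /= -ltnS.
have /cyclicP[g gen_g] := field_unit_group_cyclic [set: {unit 'F_p}].
have g_order : #[g]%g = p.-1 by rewrite orderE -gen_g card_Fp_unit.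
pose us (i : 'I_n.+1) := (g ^+ (p.-1 %/ 2 ^ i))%g.
have us_order i : #[us i]%g = (2 ^ i)%N.
  have p1_gt0 : (0 < p.-1)%N by rewrite -g_order.
  rewrite orderXdiv g_order; last exact: dvdn_div.
  by rewrite divnA ?mulKn.
have us4 i : (us i ^+ 4 = 1)%g.
  by apply/eqP; rewrite -order_dvdn us_order (dvdn_exp2l 2 (n_le i : i <= 2)%N).
exists (fun i => dic_brace (us4 i)); split; first split.
- by move=> i; apply: dic_brace_C12_Dic12.
- move=> i j /(dic_brace_isoP p_prime p_ge7); rewrite !us_order => /eqP.
  by rewrite eqn_exp2l // => /eqP/val_inj.
- move=> C /C12_Dic12_brace_dic_brace[u [u4 isoCu]].
  have /(dvdn_pfactor _ _ (isT : prime 2))[k k_le2 ou] : (#[u]%g %| 2 ^ 2)%N.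
    by rewrite order_dvdn u4.
  have k_le_n : (k < n.+1)%N.
    rewrite ltnS -(dvd_p (Ordinal (k_le2 : (k < 3)%N))) /= -ou -card_Fp_unit.
    by rewrite order_dvdG ?inE.
  exists (Ordinal k_le_n); apply: brace_iso_trans isoCu _.
  by apply/dic_brace_isoP; rewrite // us_order.
- exists dic, (dic_char (us4 0)); split; first exact: dic_order.
    exact: brace_iso_refl.
  have us0 : us 0 = 1%g by apply/eqP; rewrite -order_eq1 us_order.
  by move=> z; rewrite -[LHS]/(us 0 ^+ (z : 'Z_12))%g us0 expg1n.
- by move=> i; rewrite -us_order; apply: dic_brace_kernel.
Qed.

End Classification.

Theorem proposition18 (p : nat) (p_prime : prime p) (p_ge7 : (7 <= p)%N) :
  ((p != 1 %[mod 4])%N ->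
     exists B : 'I_2 -> leftBraceType,
       [/\ classifies (C12_Dic12_brace p) B,
           is_direct_product p (B 0)
         & has_kernel_of_order p (B 1) 6])
  /\
  ((p == 1 %[mod 4])%N ->
     exists B : 'I_3 -> leftBraceType,
       [/\ classifies (C12_Dic12_brace p) B,
           is_direct_product p (B 0),
           has_kernel_of_order p (B 1) 6
         & has_kernel_of_order p (B 2) 3]).
Proof.
have p_gt0 := prime_gt0 p_prime.
have dvd2 : (2 %| p.-1)%N.
  have [p2|] := even_prime p_prime; first by rewrite p2 in p_ge7.
  by rewrite dvdn2 -[in odd p](prednK p_gt0) /= => ->.
have dvd4 : (4 %| p.-1)%N = (p == 1 %[mod 4])%N.
  by rewrite -subn1 eqn_mod_dvd.
split=> p4.
  case: (@dic_braces_up_to_iso p p_prime p_ge7 1 isT) => [|B [Bcl B0 Bker]].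
    by case=> -[|[|[|]]] //= _; rewrite ?expn1 ?dvd1n // dvd4 (negPf p4).
  by exists B; split; [exact: Bcl | exact: B0 | exact: (Bker 1)].
case: (@dic_braces_up_to_iso p p_prime p_ge7 2 isT) => [|B [Bcl B0 Bker]].
  by case=> -[|[|[|]]] //= _; rewrite ?expn1 ?dvd1n // dvd4.
by exists B; split; [exact: Bcl | exact: B0 | exact: (Bker 1) | exact: (Bker 2)].
Qed.
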